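(* Let $(K_f,A_g)$ be a Riemann–Roch pair in the general sense, given by a finite set $S=\{E_1,\dots,E_n\}$ with rank function $\mathrm{rk}\colon S\to\mathbb{N}_{>0}$, with associated $\Sigma,\Gamma,\Lambda$ and embeddings $\iota\colon\mathrm{Sh}_{\mathbb{Q}}(\Sigma)\hookrightarrow\mathrm{Sh}_{\mathbb{Q}}(\Lambda)$, $\nu\colon\mathrm{Diff}_{\mathbb{Q}}[[\Gamma]]\hookrightarrow\mathrm{Diff}_{\mathbb{Q}}[[\Lambda]]$. Then there exists a homogeneous polynomial $h$ on $\Lambda$ such that the commutative square $$\nu\circ\mathrm{ch}=\mathrm{ch}\circ\iota\colon\mathrm{Sh}_{\mathbb{Q}}(\Sigma)\to\mathrm{Diff}_{\mathbb{Q}}[[\Lambda]]$$ descends to a commutative square on the quotients: $\mathrm{ch}$, $\iota$ and $\nu$ induce maps $\mathrm{ch}\colon\mathbb{Q}K_f\to\mathbb{Q}A_g$, $\mathrm{ch}\colon\mathbb{Q}K_h\to\mathbb{Q}A_h$, and injective maps $\iota\colon\mathbb{Q}K_f\hookrightarrow\mathbb{Q}K_h$, $\nu\colon\mathbb{Q}A_g\hookrightarrow\mathbb{Q}A_h$, with $\nu\circ\mathrm{ch}=\mathrm{ch}\circ\iota$ on $\mathbb{Q}K_f$.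
   Context: Let $\Sigma$ be the free commutative monoid on symbols $\lambda^k(E_i)$ and $\Gamma$ the free abelian group on symbols $c_k(E_i)$, for $1\le i\le n$, $1\le k\le\mathrm{rk}(E_i)$; $\Gamma$ is graded with $c_k(E_i)$ in degree $k$. Let $\Lambda$ be the free abelian group on symbols $u_{i,j}$, $1\le i\le n$, $1\le j\le\mathrm{rk}(E_i)$. $\mathrm{Sh}(\Sigma)=\mathbb{Z}[\Sigma]$ is the monoid algebra with basis $T^u$ (so it is the polynomial ring in the $\lambda^k(E_i)$, where $\lambda^k(E_i)$ also denotes the corresponding basis element), acting on functions on $\Sigma$ by $(T^uh)(x)=h(x+u)$; likewise $\mathrm{Sh}(\Lambda)=\mathbb{Z}[\Lambda]$. $\mathrm{Diff}(\Gamma)$ is the ring of constant-coefficient differential operators with integer coefficients acting on polynomial functions $\Gamma\to\mathbb{Q}$ (rational coefficients); it is the polynomial ring in the directional derivatives along the $c_k(E_i)$, again denoted $c_k(E_i)$. Likewise $\mathrm{Diff}(\Lambda)=\mathbb{Z}[\partial_{u_{i,j}}]$. $\mathbb{Q}R=\mathbb{Q}\otimes_{\mathbb{Z}}R$, $\mathrm{Sh}_{\mathbb{Q}}=\mathbb{Q}\,\mathrm{Sh}$, and $\mathrm{Diff}_{\mathbb{Q}}[[\cdot]]$ is the completion of $\mathbb{Q}\,\mathrm{Diff}$ at the ideal generated by the directional derivatives (power series ring). For a function $f\colon\Sigma\to\mathbb{Q}$, $K_f=\mathrm{Sh}(\Sigma)/\mathrm{Ann}(f)$; for a polynomial $g$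 on $\Gamma$, $A_g=\mathrm{Diff}(\Gamma)/\mathrm{Ann}(g)$; similarly $K_h=\mathrm{Sh}(\Lambda)/\mathrm{Ann}(h)$ and $A_h=\mathrm{Diff}(\Lambda)/\mathrm{Ann}(h)$ for a polynomial $h$ on $\Lambda$ ($\mathrm{Ann}$: ideal of operators killing the function). With $\sigma_k$ the $k$-th elementary symmetric polynomial, $\iota$ is the ring embedding $\lambda^k(E_i)\mapsto\sigma_k(T^{u_{i,1}},\dots,T^{u_{i,\mathrm{rk}(E_i)}})$ and $\nu$ the ring embedding $c_k(E_i)\mapsto\sigma_k(\partial_{u_{i,1}},\dots,\partial_{u_{i,\mathrm{rk}(E_i)}})$. The Chern character $\mathrm{ch}\colon\mathrm{Sh}_{\mathbb{Q}}(\Lambda)\to\mathrm{Diff}_{\mathbb{Q}}[[\Lambda]]$ is the algebra homomorphism $T^u\mapsto\exp(\partial_u)$; since $\mathrm{ch}(\iota(\mathrm{Sh}_{\mathbb{Q}}(\Sigma)))\subseteq\nu(\mathrm{Diff}_{\mathbb{Q}}[[\Gamma]])$, it restricts to a homomorphism $\mathrm{ch}\colon\mathrm{Sh}_{\mathbb{Q}}(\Sigma)\to\mathrm{Diff}_{\mathbb{Q}}[[\Gamma]]$ with $\nu\circ\mathrm{ch}=\mathrm{ch}\circ\iota$. $(K_f,A_g)$, with $f\colon\Sigma\to\mathbb{Q}$ a function and $g$ a weighted homogeneous polynomial on $\Gamma$, is a Riemann–Roch pair if the composite $\mathrm{Sh}_{\mathbb{Q}}(\Sigma)\to\mathrm{Diff}_{\mathbb{Q}}[[\Gamma]]\to\mathbb{Q}A_g$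 of $\mathrm{ch}$ with the quotient map descends to an isomorphism $\mathrm{ch}\colon\mathbb{Q}K_f\cong\mathbb{Q}A_g$. *)

(* Defs.v *)
From HB Require Import structures.
From mathcomp Require Import all_boot all_order all_algebra.
From mathcomp Require Import boolp.
From mathcomp Require Import freeg mpoly.

Set Implicit Arguments.
Unset Strict Implicit.
Unset Printing Implicit Defensive.

Import GRing.Theory Num.Theory.

Local Open Scope ring_scope.

(* -------------------------------------------------------------------- *)
(* Ideal generated by a subset G of a commutative ring S, and S / (G).
   The quotient may be the zero ring, hence [comPzRingType].            *)

Section IdealQuotient.
Variables (S : comNzRingType) (G : S -> Prop).

Definition ideal_gen : {pred S} := fun x =>
  `[< exists s : seq (S * S),
        (forall p, p \in s -> G p.2) /\ x = \sum_(p <- s) p.1 * p.2 >].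

Lemma ideal_genM a x : x \in ideal_gen -> a * x \in ideal_gen.
Proof.
move=> /asboolP[s [Gs ->]]; apply/asboolP.
exists [seq (a * p.1, p.2) | p <- s]; split; first by move=> _ /mapP[p /Gs ? ->].
by rewrite big_map mulr_sumr; apply: eq_bigr => p _; rewrite mulrA.
Qed.

Lemma ideal_gen_zmod : zmod_closed ideal_gen.
Proof.
split=> [|x y + yG]; first by apply/asboolP; exists [::]; rewrite big_nil.
have := ideal_genM (-1) yG; rewrite mulN1r.
move=> /asboolP[t [Gt ->]] /asboolP[s [Gs ->]]; apply/asboolP.
exists (s ++ t); split; last by rewrite big_cat.
by move=> p; rewrite mem_cat => /orP[/Gs|/Gt].
Qed.

HB.instance Definition _ := GRing.isZmodClosed.Build S ideal_gen ideal_gen_zmod.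

Definition quotring : Type := Quotient.quot ideal_gen.

HB.instance Definition _ := Choice.on quotring.
HB.instance Definition _ := GRing.Zmodule.on quotring.

Definition qproj (x : S) : quotring := \pi_(Quotient.quot ideal_gen)%qT x.
Definition qrepr (x : quotring) : S := repr (x : Quotient.quot ideal_gen).

Lemma qreprK : cancel qrepr qproj. Proof. exact: reprK. Qed.

Lemma qprojP x y : qproj x = qproj y <-> x - y \in ideal_gen.
Proof. by rewrite Quotient.idealrBE; split=> [/eqP|/eqP]. Qed.

Lemma qprojD : {morph qproj : x y / x + y}.
Proof. by move=> x y; rewrite /qproj piE. Qed.

Definition qone : quotring := qproj 1.
Definition qmul (x y : quotring) : quotring := qproj (qrepr x * qrepr y).

Lemma qprojM x y : qproj (x * y) = qmul (qproj x) (qproj y).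
Proof.
have qrP z : z - qrepr (qproj z) \in ideal_gen by apply/qprojP; rewrite qreprK.
apply/qprojP; set x' := qrepr _; set y' := qrepr _.
have -> : x * y - x' * y' = y * (x - x') + x' * (y - y').
  by rewrite !mulrBr [y * x]mulrC [y * x']mulrC addrA subrK.
by rewrite rpredD // ideal_genM ?qrP.
Qed.

Lemma qmulA : associative qmul.
Proof.
move=> x y z; rewrite -(qreprK x) -(qreprK y) -(qreprK z).
by rewrite -!qprojM mulrA.
Qed.

Lemma qmulC : commutative qmul.
Proof. by move=> x y; rewrite /qmul mulrC. Qed.

Lemma qmul1 : left_id qone qmul.
Proof. by move=> x; rewrite -(qreprK x) -qprojM mul1r. Qed.

Lemma qmulDl : left_distributive qmul +%R.
Proof.
move=> x y z; rewrite -(qreprK x) -(qreprK y) -(qreprK z).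
by rewrite -qprojD -!qprojM -qprojD mulrDl.
Qed.

HB.instance Definition _ := GRing.Zmodule_isComPzRing.Build quotring
  qmulA qmulC qmul1 qmulDl.

End IdealQuotient.

(* -------------------------------------------------------------------- *)
(* Group algebra R[M] of an abelian group M: finitely supported formal
   sums of elements of M, with convolution product.                     *)

Section GroupAlgebra.
Variables (R : comNzRingType) (M : zmodType).

Definition galg : Type := {freeg M / R}.

HB.instance Definition _ := Choice.on galg.
HB.instance Definition _ := GRing.Zmodule.on galg.
HB.instance Definition _ := GRing.Lmodule.on galg.

Definition galgU (c : R) (u : M) : galg := << c *g u >>.

Definition galg_mul (A B : galg) : galg :=
  \sum_(u <- dom A) \sum_(v <- dom B) galgU (coeff u A * coeff v B) (u + v).

Let lin (F : M -> galg) (A : galg) : galg := fglift (F : M -> {freeg M / R}) A.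

Let linD F : {morph lin F : A B / A + B}.
Proof.
move=> A B.
have linB (X Y : galg) : lin F (X - Y) = lin F X - lin F Y.
  exact: (@lift_is_additive R M {freeg M / R} F X Y).
have lin00 : lin F 0 = 0 by rewrite -[X in lin F X](subrr (0 : galg)) linB subrr.
by rewrite -{1}[B]opprK linB -sub0r linB lin00 sub0r opprK.
Qed.

Let lin0 F : lin F 0 = 0.
Proof. by apply: (@addIr _ (lin F 0)); rewrite -linD !add0r. Qed.

Let linE F A : lin F A = \sum_(u <- dom A) coeff u A *: F u.
Proof.
rewrite -[X in lin F X]freeg_sumE.
elim: (dom A) => [|u s IH]; first by rewrite !big_nil lin0.
by rewrite !big_cons linD IH /lin liftU.
Qed.

Let linZ F c A : lin F (c *: A) = c *: lin F A.
Proof.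
elim/freeg_ind_dom0: A => [|k u A _ _ IH].
  by rewrite scaler0 lin0 scaler0.
rewrite scalerDr !linD IH scalerDr; congr (_ + _).
have -> : c *: << k *g u >> = << c * k *g u >> :> {freeg M / R}.
  by apply/eqP/freeg_eqP => v; rewrite coeffZ !coeffU mulrA.
by rewrite /lin !liftU scalerA.
Qed.

Let linU F c u : lin F (galgU c u) = c *: F u. Proof. exact: liftU. Qed.

Let shiftU (u : M) (B : galg) : galg := lin (fun v => galgU 1 (u + v)) B.

Let scaleU (c k : R) u : c *: galgU k u = galgU (c * k) u.
Proof. by apply/eqP/freeg_eqP => v; rewrite coeffZ !coeffU mulrA. Qed.

Let mulE A B : galg_mul A B = lin (shiftU^~ B) A.
Proof.
rewrite linE; apply: eq_bigr => u _; rewrite /shiftU linE scaler_sumr.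
by apply: eq_bigr => v _; rewrite !scaleU mulr1.
Qed.

Let mulDl : left_distributive galg_mul +%R.
Proof. by move=> A B C; rewrite !mulE linD. Qed.

Let mulZl c A B : galg_mul (c *: A) B = c *: galg_mul A B.
Proof. by rewrite !mulE linZ. Qed.

Let mulC : commutative galg_mul.
Proof.
move=> A B; rewrite /galg_mul exchange_big /=; apply: eq_bigr => u _.
by apply: eq_bigr => v _; rewrite mulrC addrC.
Qed.

Let mulDr : right_distributive galg_mul +%R.
Proof. by move=> A B C; rewrite mulC mulDl ![galg_mul A _]mulC. Qed.

Let mulZr c A B : galg_mul A (c *: B) = c *: galg_mul A B.
Proof. by rewrite mulC mulZl mulC. Qed.

Lemma galg_mulU (c d : R) u v :
  galg_mul (galgU c u) (galgU d v) = galgU (c * d) (u + v).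
Proof. by rewrite mulE linU /shiftU linU !scaleU mulr1. Qed.

Let mul0l A : galg_mul 0 A = 0.
Proof. by rewrite mulE lin0. Qed.

Let mul0r A : galg_mul A 0 = 0.
Proof. by rewrite mulC mul0l. Qed.

Let mulA : associative galg_mul.
Proof.
move=> A B C.
elim/freeg_ind_dom0: A => [|a u A _ _ IHA]; first by rewrite !mul0l.
rewrite !mulDl IHA; congr (_ + _) => {A IHA}.
elim/freeg_ind_dom0: B => [|b v B _ _ IHB]; first by rewrite !(mul0l, mul0r).
rewrite !(mulDl, mulDr) IHB; congr (_ + _) => {B IHB}.
elim/freeg_ind_dom0: C => [|c w C _ _ IHC]; first by rewrite !mul0r.
rewrite !mulDr IHC; congr (_ + _).
by rewrite -![<< _ *g _ >>]/(galgU _ _) !galg_mulU mulrA addrA.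
Qed.

Let mul1 : left_id (galgU 1 0) galg_mul.
Proof.
move=> A; elim/freeg_ind_dom0: A => [|c u A _ _ IH]; first by rewrite mul0r.
rewrite mulDr IH; congr (_ + _).
by rewrite -[<< c *g u >>]/(galgU _ _) galg_mulU mul1r add0r.
Qed.

Let one_neq0 : galgU 1 0 != 0.
Proof. by rewrite freegU_eq0 oner_eq0. Qed.

HB.instance Definition _ := GRing.Zmodule_isComNzRing.Build galg
  mulA mulC mul1 mulDl one_neq0.

End GroupAlgebra.

(* Change of coefficients from Z to Q. *)
Definition galgQ (M : zmodType) (D : galg int M) : galg rat M :=
  \sum_(u <- dom D) galgU (coeff u D)%:~R u.

(* -------------------------------------------------------------------- *)
Section RiemannRoch.
Variables (n : nat) (rk : 'I_n -> nat).

(* The pair (i, k) stands for lambda^(k+1)(E_i), c_(k+1)(E_i) or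
   u_(i, k+1); these symbols are numbered by [idx].                      *)
Definition nsym : nat := #|{: {i : 'I_n & 'I_(rk i)}}|.

Definition idx (i : 'I_n) (k : 'I_(rk i)) : 'I_nsym :=
  enum_rank (Tagged (fun i => 'I_(rk i)) k).

Definition symb (l : 'I_nsym) : {i : 'I_n & 'I_(rk i)} := enum_val l.

Definition wgt (m : 'X_{1..nsym}) : nat := (\sum_l m l * (tagged (symb l)).+1)%N.

Lemma wgt0 : wgt 0%MM = 0%N.
Proof. by rewrite /wgt big1 // => l _; rewrite mnm0E mul0n. Qed.

Lemma wgtD : {morph wgt : m1 m2 / (m1 + m2)%MM >-> (m1 + m2)%N}.
Proof.
move=> m1 m2; rewrite /wgt -big_split /=; apply: eq_bigr => l _.
by rewrite mnmDE mulnDl.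
Qed.

HB.instance Definition _ := isMeasure.Build nsym wgt wgt0 wgtD.

(* Sigma, written additively; Sh(Sigma) = {mpoly int[nsym]}, T^u = 'X_[u]. *)
Definition Sigma := 'X_{1..nsym}.
(* Lambda, in coordinates on the basis (u_(i,j)). *)
Definition Lambda := 'rV[int]_nsym.

Definition ShLambda := galg int Lambda.
Definition ShLambdaQ := galg rat Lambda.

(* Polynomial functions on Gamma or on Lambda, in the coordinates dual to
   the c_k(E_i) or to the u_(i,j).                                        *)
Definition polyfun := {mpoly rat[nsym]}.

Definition shift_Sigma (D : {mpoly int[nsym]}) (f : Sigma -> rat) : Sigma -> rat :=
  fun x => \sum_(u <- msupp D) (D@_u)%:~R * f (x + u)%MM.

Definition shift_Lambda (D : ShLambda) (h : Lambda -> rat) : Lambda -> rat :=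
  fun x => \sum_(u <- dom D) (coeff u D)%:~R * h (x + u).

Definition fun_of_poly (h : polyfun) : Lambda -> rat :=
  fun x => h.@[fun l => (x 0 l)%:~R].

(* Diff(Gamma) and Diff(Lambda): the variable 'X_l is the derivative along
   the l-th basis vector.                                                 *)
Definition diff_act (D : {mpoly int[nsym]}) (g : polyfun) : polyfun :=
  \sum_(m <- msupp D) (D@_m)%:~R *: g^`M[m].

Definition Ann_Sigma (f : Sigma -> rat) (D : {mpoly int[nsym]}) : Prop :=
  forall x, shift_Sigma D f x = 0.

Definition Ann_Lambda (h : polyfun) (D : ShLambda) : Prop :=
  forall x, shift_Lambda D (fun_of_poly h) x = 0.

Definition Ann_Diff (g : polyfun) (D : {mpoly int[nsym]}) : Prop :=
  diff_act D g = 0.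

(* For an ideal I of a ring R, Q (x) (R/I) is the quotient of QR by the
   ideal generated by the image of I.                                     *)
Definition QK_Sigma (f : Sigma -> rat) : comPzRingType :=
  quotring (fun x : {mpoly rat[nsym]} =>
              exists2 D, Ann_Sigma f D & x = map_mpoly intr D).

Definition QK_Lambda (h : polyfun) : comPzRingType :=
  quotring (fun x : ShLambdaQ => exists2 D, Ann_Lambda h D & x = galgQ D).

Definition QA (g : polyfun) : comPzRingType :=
  quotring (fun x : {mpoly rat[nsym]} =>
              exists2 D, Ann_Diff g D & x = map_mpoly intr D).

Definition projK_Sigma (f : Sigma -> rat) (D : {mpoly rat[nsym]}) : QK_Sigma f :=
  qproj _ D.

Definition projK_Lambda (h : polyfun) (D : ShLambdaQ) : QK_Lambda h :=
  qproj _ D.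

(* Diff_Q[[Gamma]] and Diff_Q[[Lambda]]: families of coefficients. *)
Definition diffseries := 'X_{1..nsym} -> rat.

(* The operators of order at least [msize g] annihilate g, so the map
   Diff_Q[[.]] -> Q A_g factors through the truncation at that order.    *)
Definition trunc_series (d : nat) (P : diffseries) : {mpoly rat[nsym]} :=
  \sum_(m : 'X_{1..nsym < d}) P m *: 'X_[m].

Definition projA (g : polyfun) (P : diffseries) : QA g :=
  qproj _ (trunc_series (msize g) P).

Definition Tu (i : 'I_n) (j : 'I_(rk i)) : ShLambdaQ :=
  galgU 1 (delta_mx 0 (idx j)).

Definition iota_Sh (D : {mpoly rat[nsym]}) : ShLambdaQ :=
  mmap (fun c => galgU c 0 : ShLambdaQ)
       (fun l => let i := tag (symb l) in let k := tagged (symb l) in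
          (mesym (rk i) ShLambdaQ k.+1).@[fun j : 'I_(rk i) => Tu j])
       D.

Definition nu_gen (l : 'I_nsym) : {mpoly rat[nsym]} :=
  let i := tag (symb l) in let k := tagged (symb l) in
  (mesym (rk i) {mpoly rat[nsym]} k.+1).@[fun j : 'I_(rk i) => 'X_(idx j)].

(* nu(P) = \sum_a P_a nu(c)^a.  As nu(c)^a has no term of degree < mdeg a,
   only the a with mdeg a <= mdeg b contribute to the coefficient at b.   *)
Definition nu_Diff (P : diffseries) : diffseries :=
  fun b => \sum_(a : 'X_{1..nsym < (mdeg b).+1}) P a * (mmap1 nu_gen a)@_b.

Definition deriv_along (u : Lambda) : {mpoly rat[nsym]} :=
  \sum_l (u 0 l)%:~R *: 'X_l.

(* exp(d_u) = \sum_m d_u^m / m!, and d_u^m is homogeneous of degree m, so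
   only m = mdeg b contributes to the coefficient at b.                   *)
Definition exp_deriv (u : Lambda) : diffseries :=
  fun b => (deriv_along u ^+ mdeg b)@_b / (mdeg b)`!%:R.

Definition ch_Lambda (D : ShLambdaQ) : diffseries :=
  fun b => \sum_(u <- dom D) coeff u D * exp_deriv u b.

(* ch on Sh_Q(Sigma) is the restriction of ch on Sh_Q(Lambda): as nu is
   injective, ch(D) is the only series with nu(ch(D)) = ch(iota(D)).      *)
Definition ch_Sigma (D : {mpoly rat[nsym]}) : diffseries :=
  if pselect (exists P, nu_Diff P = ch_Lambda (iota_Sh D)) is left exP
  then projT1 (cid exP) else fun=> 0.

Definition Riemann_Roch_pair (f : Sigma -> rat) (g : polyfun) : Prop :=
  (exists d, g \is d.-homog for wgt) /\
  exists phi : {rmorphism QK_Sigma f -> QA g},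
    bijective phi /\ forall D, phi (projK_Sigma f D) = projA g (ch_Sigma D).

End RiemannRoch.

(* Main.v *)
(** Let l_g be the functional D |-> (D g)(0) on Diff_Q(Gamma), so that D
    annihilates g iff l_g vanishes on the ideal generated by D.  Averaging over
    the symmetric groups and the fundamental theorem on symmetric polynomials
    give a graded retraction pi of nu : Q[c] -> Q[u] that is Q[c]-linear, i.e.
    pi (nu D * P) = D * pi P.  The polynomial h whose functional is l_g \o pi
    is then homogeneous, and nu D annihilates h iff D annihilates g; hence nu
    descends to an injection Q A_g -> Q A_h.

    On the K-side, Taylor's formula h(x + u) = (exp(d_u) h)(x) shows that
    D in Sh_Q(Lambda) kills h iff the polynomial ch(D) h vanishes at all
    integral points, i.e. iff ch(D) kills h, so ch : Q K_h -> Q A_h is well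
    defined and injective.  The statements on iota follow by a chase in the
    square, as ch : Q K_f -> Q A_g is bijective.  The coefficients of
    ch(iota D) are symmetric, which gives ch(iota D) = nu(ch D). *)

Require Import Defs.
From HB Require Import structures.
From mathcomp Require Import all_boot all_order all_algebra all_fingroup.
From mathcomp Require Import boolp.
From mathcomp Require Import ssrcomplements freeg mpoly.

Set Implicit Arguments.
Unset Strict Implicit.
Unset Printing Implicit Defensive.

Import GRing.Theory Num.Theory.

Local Open Scope ring_scope.

(** * The apolar pairing of polynomials and differential operators *)

Section MonomialExtension.
Variables (R : comNzRingType) (n : nat) (V : lmodType R).

Definition mlift (F : 'X_{1..n} -> V) (p : {mpoly R[n]}) : V :=
  \sum_(m <- msupp p) p@_m *: F m.

(** Summing over a bound common to several polynomials makes linearity of [mlift] a termwise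
    identity. *)
Lemma mliftwE F p k : (msize p <= k)%N ->
  mlift F p = \sum_(m : 'X_{1..n < k}) p@_m *: F m.
Proof.
move=> le_pk; rewrite /mlift (big_mksub 'X_{1..n < k}) ?msupp_uniq //=; last first.
  by move=> m /msize_mdeg_lt /leq_trans; apply.
by rewrite big_rmcond //= => m /memN_msupp_eq0 ->; rewrite scale0r.
Qed.

Lemma mlift_is_linear F : linear (mlift F).
Proof.
move=> c p q; set k := maxn (msize (c *: p + q)) (maxn (msize p) (msize q)).
rewrite !(@mliftwE F _ k) ?leq_max ?leqnn ?orbT //.
rewrite scaler_sumr -big_split; apply: eq_bigr => m _.
by rewrite mcoeffD mcoeffZ scalerDl scalerA.
Qed.

HB.instance Definition _ F :=
  GRing.isLinear.Build R {mpoly R[n]} V _ (mlift F) (mlift_is_linear F).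

Lemma mliftX F m : mlift F 'X_[m] = F m.
Proof. by rewrite /mlift msuppX big_seq1 mcoeffX eqxx scale1r. Qed.

End MonomialExtension.

Section ApolarPairing.
Variable n : nat.
Implicit Types (g P : {mpoly rat[n]}) (m : 'X_{1..n}).

Definition mnmfact m : nat := (\prod_i (m i)`!)%N.

Lemma mnmfact_neq0 m : (mnmfact m)%:R != 0 :> rat.
Proof.
by rewrite pnatr_eq0 -lt0n /mnmfact prodn_gt0 // => i; exact: fact_gt0.
Qed.

(* The value at 0 of P(d/dx) g. *)
Definition pairing g P : rat^o :=
  mlift (fun m => g@_m * (mnmfact m)%:R : rat^o) P.

HB.instance Definition _ g :=
  GRing.isLinear.Build rat {mpoly rat[n]} rat^o _ (pairing g) (mlift_is_linear _).

Lemma pairingX g m : pairing g 'X_[m] = g@_m * (mnmfact m)%:R.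
Proof. exact: mliftX. Qed.

Lemma pairingZ g c P : pairing g (c *: P) = c * pairing g P.
Proof. exact: linearZ. Qed.

Definition dact P g : {mpoly rat[n]} := mlift (fun m => g^`M[m]) P.

(** Up to b!, the coefficient at b is the value at 0 of the b-th derivative, so it is obtained by
    pairing with one more monomial. *)
Lemma dact_coef P g b :
  (dact P g)@_b * (mnmfact b)%:R = pairing g (P * 'X_[b]).
Proof.
rewrite /dact /mlift raddf_sum mulr_suml [P in RHS]mpolyE mulr_suml raddf_sum.
apply: eq_bigr => m _.
rewrite /= mcoeffZ mcoeff_mderivm -scalerAl pairingZ -mpolyXD pairingX.
rewrite -mulrA; congr (_ * _); rewrite -[_ *+ \prod_(i < n) _]mulr_natr -mulrA -natrM.
congr (_ * _%:R).
rewrite /mnmfact -big_split /=; apply: eq_bigr => i _.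
by rewrite mnmDE -{2}(addKn (m i) (b i)) ffact_fact // leq_addr.
Qed.

Lemma dact_eq0 P g :
  dact P g = 0 <-> forall Q, pairing g (P * Q) = 0.
Proof.
split=> [P0 Q|P0].
  rewrite [Q]mpolyE mulr_sumr raddf_sum /= big1 // => m _.
  by rewrite -scalerAr pairingZ -dact_coef P0 mcoeff0 mul0r mulr0.
apply/mpolyP => b; rewrite mcoeff0; apply: (mulIf (mnmfact_neq0 b)).
by rewrite dact_coef P0 mul0r.
Qed.

(** Every monomial of P * Q has degree at least [msize g], beyond all monomials of g. *)
Lemma pairing_high g P Q :
  (forall b, (mdeg b < msize g)%N -> P@_b = 0) -> pairing g (P * Q) = 0.
Proof.
move=> P0; rewrite [P]mpolyE mulr_suml raddf_sum big1_seq // => m /andP[_ mP] /=.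
rewrite [Q]mpolyE mulr_sumr raddf_sum big1 // => q _ /=.
rewrite -scalerAr -scalerAl !pairingZ -mpolyXD pairingX.
have le_gm: (msize g <= mdeg m)%N.
  by rewrite leqNgt; apply/negP => /P0 /eqP; rewrite mcoeff_eq0 mP.
rewrite [g@__]memN_msupp_eq0 ?mul0r ?mulr0 //.
apply: contraL (le_gm) => /msize_mdeg_lt; rewrite mdegD -ltnNge.
exact: leq_ltn_trans (leq_addr _ _).
Qed.

Lemma pairing_eq_low g P P' Q :
  (forall b, (mdeg b < msize g)%N -> P@_b = P'@_b) ->
  pairing g (P * Q) = pairing g (P' * Q).
Proof.
move=> PP'; apply/eqP; rewrite -subr_eq0 -raddfB -mulrBl.
apply/eqP/pairing_high => b /PP'.
by rewrite mcoeffB => ->; rewrite subrr.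
Qed.

End ApolarPairing.

(** [numq] names the integers explicitly, so the cleared element can be written down as a sum with
    integer coefficients, both for polynomials and in the group algebra. *)
Lemma rat_common_den (T : eqType) (s : seq T) (c : T -> rat) :
  exists2 k : int, k != 0 &
    {in s, forall x, (numq (k%:~R * c x))%:~R = k%:~R * c x}.
Proof.
suff [k k0 kP] : exists2 k : int, k != 0 &
    forall x, x \in s -> exists z : int, k%:~R * c x = z%:~R.
  by exists k => // x /kP[z ->]; rewrite numq_int.
elim: s => [|x s [k k0 IH]]; first by exists 1.
exists (k * denq (c x)); first by rewrite mulf_neq0 ?denq_neq0.
move=> y; rewrite inE => /orP[/eqP->|/IH [z zP]].
  by exists (k * numq (c x)); rewrite !rmorphM /= numqE mulrA mulrAC.
by exists (denq (c x) * z); rewrite !rmorphM /= mulrAC zP mulrC.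
Qed.

Lemma mpoly_clear_den n (P : {mpoly rat[n]}) :
  exists2 k : int, k != 0 & exists D, map_mpoly intr D = k%:~R *: P.
Proof.
have [k k0 kP] := rat_common_den (msupp P) (fun m => P@_m).
exists k => //; exists (\sum_(m <- msupp P) numq (k%:~R * P@_m) *: 'X_[m]).
rewrite raddf_sum [P in RHS]mpolyE scaler_sumr /= big_seq [RHS]big_seq.
by apply: eq_bigr => m mP; rewrite map_mpolyZ map_mpolyX /= kP // scalerA.
Qed.

(** * Ring morphisms out of a quotient *)

Section QuotientMorphisms.
Variables (S : comNzRingType) (G : S -> Prop).

Lemma qproj_zmod_morphism : zmod_morphism (qproj G).
Proof.
move=> x y; apply: (@addIr _ (qproj G y)).
by rewrite -qprojD !subrK.
Qed.

HB.instance Definition _ :=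
  GRing.isZmodMorphism.Build S (quotring G) (qproj G) qproj_zmod_morphism.

Lemma qproj_monoid_morphism : monoid_morphism (qproj G).
Proof. by split=> // x y; rewrite qprojM. Qed.

HB.instance Definition _ :=
  GRing.isMonoidMorphism.Build S (quotring G) (qproj G) qproj_monoid_morphism.

Lemma qproj_eq0 x : qproj G x = 0 <-> x \in ideal_gen G.
Proof. by rewrite -(rmorph0 (qproj G)) qprojP subr0. Qed.

Lemma ideal_gen_mem x : G x -> x \in ideal_gen G.
Proof.
move=> Gx; apply/asboolP; exists [:: (1, x)].
by rewrite big_seq1 mul1r; split=> // p; rewrite inE => /eqP->.
Qed.

Section Lift.
Variables (T : comPzRingType) (F : {rmorphism S -> T}).
Hypothesis FG : forall x, G x -> F x = 0.

Lemma rmorph_ideal_gen x : x \in ideal_gen G -> F x = 0.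
Proof.
move=> /asboolP[s [Gs ->]]; rewrite rmorph_sum big1_seq // => p /andP[_ /Gs /FG].
by rewrite rmorphM => ->; rewrite mulr0.
Qed.

Definition quot_lift (x : quotring G) : T := F (qrepr x).

Lemma quot_liftE x : quot_lift (qproj G x) = F x.
Proof.
apply/eqP; rewrite -subr_eq0 -rmorphB; apply/eqP/rmorph_ideal_gen.
by apply/qprojP; rewrite qreprK.
Qed.

Lemma quot_lift_zmod_morphism : zmod_morphism quot_lift.
Proof.
move=> x y; rewrite -[x]qreprK -[y]qreprK -rmorphB !quot_liftE.
exact: rmorphB.
Qed.

HB.instance Definition _ := GRing.isZmodMorphism.Build (quotring G) T
  quot_lift quot_lift_zmod_morphism.

Lemma quot_lift_monoid_morphism : monoid_morphism quot_lift.
Proof.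
split=> [|x y]; first by rewrite -(rmorph1 (qproj G)) quot_liftE rmorph1.
rewrite -[x]qreprK -[y]qreprK -rmorphM !quot_liftE.
exact: rmorphM.
Qed.

HB.instance Definition _ := GRing.isMonoidMorphism.Build (quotring G) T
  quot_lift quot_lift_monoid_morphism.

Lemma quot_rmorphism :
  exists phi : {rmorphism quotring G -> T}, forall x, phi (qproj G x) = F x.
Proof. by exists quot_lift; exact: quot_liftE. Qed.

End Lift.
End QuotientMorphisms.

(** * Vanishing in Q A_g in terms of the pairing *)

Section DiffQuotient.
Variables (n : nat) (rk : 'I_n -> nat).
Implicit Types g : polyfun rk.

Lemma diff_actE (D : {mpoly int[nsym rk]}) g :
  diff_act D g = dact (map_mpoly intr D) g.
Proof.
have -> : map_mpoly intr D = \sum_(m <- msupp D) (D@_m)%:~R *: 'X_[m] :> {mpoly rat[_]}.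
  rewrite {1}[D]mpolyE raddf_sum; apply: eq_bigr => m _.
  by rewrite /= map_mpolyZ map_mpolyX.
rewrite [dact _ _](linear_sum (mlift _)); apply: eq_bigr => m _.
by rewrite linearZ /= mliftX.
Qed.

(** The right-hand side says that P kills g. Clearing denominators makes such a P integral, so the
    integral annihilators generate the whole rational annihilator. *)
Lemma QA_eq0 g P :
  (qproj _ P = 0 :> QA g) <-> forall Q, pairing g (P * Q) = 0.
Proof.
rewrite qproj_eq0; split=> [/asboolP[s [Gs ->]] Q|P0].
  rewrite mulr_suml raddf_sum big1_seq // => p /andP[_ /Gs[D AD ->]] /=.
  rewrite [p.1 * _]mulrC -mulrA; apply/dact_eq0: (p.1 * Q).
  by rewrite -diff_actE.
have [k k0 [D DP]] := mpoly_clear_den P.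
have -> : P = (k%:~R^-1)%:MP * map_mpoly intr D.
  by rewrite DP mul_mpolyC scalerA mulVf ?scale1r // intr_eq0.
apply/ideal_genM/ideal_gen_mem; exists D => //.
rewrite /Ann_Diff diff_actE; apply/dact_eq0 => Q.
by rewrite DP -scalerAl pairingZ P0 mulr0.
Qed.

Lemma QA_eq_low g P Q :
  (forall b, (mdeg b < msize g)%N -> P@_b = Q@_b) ->
  qproj _ P = qproj _ Q :> QA g.
Proof.
move=> PQ; apply/eqP; rewrite -subr_eq0 -rmorphB; apply/eqP/QA_eq0 => X.
by rewrite mulrBl raddfB /= (pairing_eq_low _ PQ) subrr.
Qed.

Lemma mcoeff_trunc d (P : diffseries rk) b :
  (trunc_series d P)@_b = if (mdeg b < d)%N then P b else 0.
Proof.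
rewrite /trunc_series raddf_sum /=; case: ifP => [lt_bd|ge_bd].
  rewrite (bigD1 (BMultinom lt_bd)) //= mcoeffZ mcoeffX eqxx mulr1.
  rewrite big1 ?addr0 // => m; rewrite -val_eqE /= => /negPf ne_mb.
  by rewrite mcoeffZ mcoeffX ne_mb mulr0.
rewrite big1 // => m _; rewrite mcoeffZ mcoeffX.
by case: eqP (bmdeg m) => [->|]; rewrite ?ge_bd ?mulr0.
Qed.

Lemma projA_poly g (F : diffseries rk) P :
  (forall b, (mdeg b < msize g)%N -> F b = P@_b) -> projA g F = qproj _ P.
Proof.
by move=> FP; apply: QA_eq_low => b lt_bg; rewrite mcoeff_trunc lt_bg FP.
Qed.

End DiffQuotient.

(** * A Q[c]-linear retraction of nu *)

Lemma mpoly_alg_ind (R : comNzRingType) n (K : {mpoly R[n]} -> Prop) :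
  (forall c, K c%:MP) -> (forall p q, K p -> K q -> K (p + q)) ->
  (forall p q, K p -> K q -> K (p * q)) -> (forall i, K 'X_i) -> forall p, K p.
Proof.
move=> KC KD KM KX p; rewrite [p]mpolyE.
have K0 : K 0 by rewrite -mpolyC0; exact: KC.
have K1 : K 1 by rewrite -mpolyC1; exact: KC.
elim/big_ind: _ => // m _; rewrite -mul_mpolyC mpolyXE_id; apply/KM => //.
elim/big_ind: _ => // i _; elim: (m i) => [|e IH]; first by rewrite expr0.
by rewrite exprS; exact: KM.
Qed.

Section SymmetricRetraction.
Variable r : nat.
Local Notation S := [tuple mesym r rat i.+1 | i < r].
Implicit Types p q : {mpoly rat[r]}.

(** The Reynolds operator of the symmetric group. *)
Definition symavg p : {mpoly rat[r]} := r`!%:R^-1 *: \sum_(s : 'S_r) msym s p.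

Lemma symavg_is_linear : linear symavg.
Proof.
move=> c p q; rewrite /symavg [c *: (_ *: _)]scalerA mulrC -scalerA -scalerDr.
rewrite [c *: (\sum__ _)]scaler_sumr -big_split; congr (_ *: _); apply: eq_bigr => s _.
by rewrite msymD msymZ.
Qed.

HB.instance Definition _ := GRing.isLinear.Build rat {mpoly rat[r]} {mpoly rat[r]} _
  symavg symavg_is_linear.

Lemma symavg_sym p : symavg p \is symmetric.
Proof.
apply/issymP => s; rewrite /symavg msymZ (raddf_sum (msym s)); congr (_ *: _).
rewrite [RHS](reindex_inj (mulIg s)); apply: eq_bigr => t _.
by rewrite /= msymMm.
Qed.

Lemma symavgM p q : p \is symmetric -> symavg (p * q) = p * symavg q.
Proof.
move=> /issymP p_sym; rewrite /symavg -scalerAr mulr_sumr; congr (_ *: _).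
by apply: eq_bigr => s _; rewrite msymM p_sym.
Qed.

Lemma symavg1 : symavg 1 = 1.
Proof.
rewrite /symavg (eq_bigr (fun=> 1)) => [|s _]; last exact: msym1.
rewrite sumr_const card_Sn -scaler_nat scalerA mulVf ?scale1r //.
by rewrite pnatr_eq0 -lt0n fact_gt0.
Qed.

Lemma symavg_homog d p : p \is d.-homog -> symavg p \is d.-homog.
Proof.
move=> p_homog; apply: rpredZ; apply: rpred_sum => s _.
apply/dhomogP => m; rewrite mcoeff_msupp mcoeff_sym -mcoeff_msupp.
by move/(dhomog_mf p_homog) => /=; rewrite mdeg_mperm.
Qed.

(** The average written in the elementary symmetric polynomials, with ['X_k] standing for
    [mesym r rat k.+1]. *)
Definition symretr p : {mpoly rat[r]} := symf (symavg p).

Lemma symretrK p : symretr p \mPo S = symavg p.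
Proof. by rewrite -symfP ?symavg_sym. Qed.

(** Substituting the elementary symmetric polynomials is injective, so identities for [symretr]
    follow from those for [symavg]; the next two lemmas are obtained in the same way. *)
Lemma symretr_is_linear : linear symretr.
Proof.
move=> c p q; apply: msym_fundamental_un.
by rewrite linearP /= !symretrK linearP.
Qed.

HB.instance Definition _ := GRing.isLinear.Build rat {mpoly rat[r]} {mpoly rat[r]} _
  symretr symretr_is_linear.

Lemma symretrM (k : 'I_r) p : symretr (mesym r rat k.+1 * p) = 'X_k * symretr p.
Proof.
apply: msym_fundamental_un; rewrite rmorphM /= !symretrK symavgM ?mesym_sym //.
by rewrite comp_mpolyXU -tnth_nth tnth_mktuple.
Qed.

Lemma symretr1 : symretr 1 = 1.
Proof. by apply: msym_fundamental_un; rewrite symretrK symavg1 rmorph1. Qed.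

(** [mnmwgt] gives ['X_k] the weight k+1, the degree of the elementary symmetric polynomial that
    replaces it. *)
Lemma symretr_homog d p : p \is d.-homog -> symretr p \is d.-homog for (@mnmwgt r).
Proof. by move=> p_homog; rewrite mwmwgt_homogE symretrK symavg_homog. Qed.

End SymmetricRetraction.

Section ProductRetraction.
Variables (n : nat) (rk : 'I_n -> nat).
Local Notation N := (nsym rk).
Local Notation wgt := (@wgt n rk).
Implicit Types (i : 'I_n) (l : 'I_N) (m : 'X_{1..N}).

Lemma symbK l : idx (tagged (symb l)) = l.
Proof. by rewrite /idx /symb taggedK enum_valK. Qed.

Lemma symb_idx i (k : 'I_(rk i)) : symb (idx k) = Tagged _ k.
Proof. exact: enum_rankK. Qed.

Lemma idx_inj i : injective (@idx n rk i).
Proof. by move=> j k /enum_rank_inj/eqP; rewrite eq_Tagged => /eqP. Qed.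

Lemma idx_neq i i' (j : 'I_(rk i)) (k : 'I_(rk i')) : i != i' -> idx j == idx k = false.
Proof.
by move=> ne; apply/eqP => /enum_rank_inj/(congr1 tag)/eqP; rewrite /= (negPf ne).
Qed.

(** Serves both sides of nu: the variables of the i-th factor are read as the [u_(i,j)] or as the
    [c_k(E_i)]. *)
Definition factor_incl i : {mpoly rat[rk i]} -> {mpoly rat[N]} :=
  mmap (@mpolyC N rat) (fun j : 'I_(rk i) => 'X_(idx j)).

HB.instance Definition _ i := GRing.RMorphism.on (factor_incl (i := i)).

Lemma factor_inclZ i c p : factor_incl (c *: p) = c *: @factor_incl i p.
Proof. by rewrite /factor_incl mmapZ mul_mpolyC. Qed.

HB.instance Definition _ i :=
  GRing.isScalable.Build rat {mpoly rat[rk i]} {mpoly rat[N]} _ (factor_incl (i := i)) (@factor_inclZ i).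

Lemma factor_incl_mesym i k :
  factor_incl (mesym (rk i) rat k) =
  (mesym (rk i) {mpoly rat[N]} k).@[fun j => 'X_(idx j)].
Proof.
rewrite !rmorph_sum; apply: eq_bigr => h _; rewrite !rmorph_prod.
by apply: eq_bigr => j _ /=; rewrite mevalXU /factor_incl mmapX mmap1U.
Qed.

Lemma nu_genE l :
  nu_gen l = factor_incl (mesym (rk (tag (symb l))) rat (tagged (symb l)).+1).
Proof. by rewrite factor_incl_mesym. Qed.

Definition factor_mnm i (a : 'X_{1..rk i}) : 'X_{1..N} :=
  (\sum_j U_(idx j) *+ a j)%MM.

Definition restr_mnm i m : 'X_{1..rk i} := [multinom m (idx j) | j < rk i].

Lemma factor_inclX i a : factor_incl 'X_[a] = 'X_[@factor_mnm i a].
Proof. by rewrite /factor_incl mmapX /mmap1 mprodXnE. Qed.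

Lemma restr_factor i (a : 'X_{1..rk i}) m :
  restr_mnm i (factor_mnm a + m) = (a + restr_mnm i m)%MM.
Proof.
apply/mnmP => j; rewrite mnmE !mnmDE mnm_sumE mnmE; congr (_ + _)%N.
rewrite (bigD1 j) //= mulmnE mnm1E eqxx mul1n big1 ?addn0 // => k ne_kj.
by rewrite mulmnE mnm1E (inj_eq (@idx_inj i)) (negPf ne_kj).
Qed.

Lemma restr_factor_neq i i' (a : 'X_{1..rk i}) m : i != i' ->
  restr_mnm i' (factor_mnm a + m) = restr_mnm i' m.
Proof.
move=> ne; apply/mnmP => j; rewrite !mnmE mnm_sumE big1 ?add0n // => k _.
by rewrite mulmnE mnm1E idx_neq.
Qed.

Lemma big_idx (R : Type) (e : R) (op : Monoid.com_law e) (F : 'I_N -> R) :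
  \big[op/e]_l F l = \big[op/e]_i \big[op/e]_(j < rk i) F (idx j).
Proof.
rewrite (sig_big_dep (fun=> true) (fun i (j : 'I_(rk i)) => true)
  (fun i j => F (idx j))) /=.
rewrite (reindex_onto (@enum_rank _) (@enum_val _ _)) => [|l _] /=; last exact: enum_valK.
by apply: eq_big => [[i j]|[i j] _] //=; rewrite enum_rankK eqxx.
Qed.

Lemma mdeg_restr m : mdeg m = (\sum_i mdeg (restr_mnm i m))%N.
Proof.
rewrite mdegE (@big_idx _ _ addn); apply: eq_bigr => i _.
by rewrite mdegE; apply: eq_bigr => j _; rewrite mnmE.
Qed.

Lemma wgtE m : wgt m = (\sum_i mnmwgt (restr_mnm i m))%N.
Proof.
rewrite /Defs.wgt (@big_idx _ _ addn); apply: eq_bigr => i _.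
by apply: eq_bigr => j _; rewrite mnmE symb_idx.
Qed.

Lemma wgt_factor i (a : 'X_{1..rk i}) : wgt (factor_mnm a) = mnmwgt a.
Proof.
rewrite wgtE (bigD1 i) //= -[factor_mnm a]addm0 restr_factor big1 => [|i' ne].
  by rewrite addn0 mnmwgtD [X in (_ + X)%N](_ : _ = 0)%N ?addn0 // /mnmwgt
    big1 // => j _; rewrite !mnmE.
by rewrite restr_factor_neq 1?eq_sym // /mnmwgt big1 // => j _; rewrite !mnmE.
Qed.

Lemma factor_incl_wgt i d p :
  p \is d.-homog for (@mnmwgt (rk i)) -> @factor_incl i p \is d.-homog for wgt.
Proof.
move=> p_homog; rewrite [p]mpolyE linear_sum big_seq; apply: rpred_sum => m mp /=.
rewrite factor_inclZ factor_inclX; apply: rpredZ.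
by rewrite dhomogX /= wgt_factor (dhomog_mf p_homog mp).
Qed.

Lemma dhomog_bigprod (I : Type) (s : seq I) (mf : measure N)
    (F : I -> {mpoly rat[N]}) (d : I -> nat) :
  (forall x, F x \is (d x).-homog for mf) ->
  \prod_(x <- s) F x \is (\sum_(x <- s) d x).-homog for mf.
Proof.
move=> F_homog; elim: s => [|x s IH]; first by rewrite !big_nil dhomog1.
by rewrite !big_cons; apply: dhomogM.
Qed.

(** The tensor product over i of the one-factor retractions, given on the monomial basis. *)
Definition retr_mnm m : {mpoly rat[N]} :=
  \prod_i factor_incl (symretr 'X_[restr_mnm i m]).

Definition retr : {mpoly rat[N]} -> {mpoly rat[N]} := mlift retr_mnm.

HB.instance Definition _ := GRing.Linear.copy retr (mlift retr_mnm).

Lemma retr_mnm_homog m : retr_mnm m \is (mdeg m).-homog for wgt.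
Proof.
rewrite mdeg_restr; apply: dhomog_bigprod => i.
by apply/factor_incl_wgt/symretr_homog; rewrite dhomogX /=.
Qed.

(** A polynomial in the variables of E_i meets only the i-th tensor factor. It is stated for general
    q because [nu_gen] is not a monomial; linearity in q reduces it to monomials. *)
Lemma retr_factor i q m :
  retr (factor_incl q * 'X_[m]) =
  factor_incl (symretr (q * 'X_[restr_mnm i m])) *
  \prod_(i' | i' != i) factor_incl (symretr 'X_[restr_mnm i' m]).
Proof.
elim/mpolyind: q => [|c a q _ _ IH]; first by rewrite rmorph0 !mul0r !linear0 mul0r.
rewrite rmorphD !mulrDl !linearD /= mulrDl IH; congr (_ + _).
rewrite factor_inclZ -!scalerAl !linearZ /= -scalerAl; congr (_ *: _).
rewrite factor_inclX -(mpolyXD _ (factor_mnm a) m) -(mpolyXD _ a (restr_mnm i m)).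
rewrite /retr mliftX /retr_mnm [LHS](bigD1 i erefl) /=.
rewrite restr_factor; congr (_ * _); apply: eq_bigr => i' ne.
by rewrite restr_factor_neq // eq_sym.
Qed.

Lemma retr_nu_gen l P : retr (nu_gen l * P) = 'X_l * retr P.
Proof.
elim/mpolyind: P => [|c m P _ _ IH]; first by rewrite mulr0 !linear0 mulr0.
rewrite mulrDr !linearD /= mulrDr IH; congr (_ + _).
rewrite -scalerAr !linearZ /= -scalerAr nu_genE retr_factor symretrM rmorphM /=.
rewrite /factor_incl mmapX mmap1U -/(factor_incl _) symbK.
by rewrite /retr mliftX /retr_mnm -mulrA [in RHS](bigD1 (tag (symb l))).
Qed.

Lemma retr1 : retr 1 = 1.
Proof.
rewrite -mpolyX0 /retr mliftX /retr_mnm mpolyX0; apply: big1 => i _.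
rewrite (_ : restr_mnm _ _ = 0%MM) ?mpolyX0 ?symretr1 ?rmorph1 //.
by apply/mnmP => j; rewrite !mnmE.
Qed.

Definition nu : {mpoly rat[N]} -> {mpoly rat[N]} := mmap (@mpolyC N rat) (@nu_gen n rk).

HB.instance Definition _ := GRing.RMorphism.on nu.

Lemma nuZ c p : nu (c *: p) = c *: nu p.
Proof. by rewrite /nu mmapZ mul_mpolyC. Qed.

HB.instance Definition _ := GRing.isScalable.Build rat {mpoly rat[N]} {mpoly rat[N]} _
  nu nuZ.

Lemma nuX m : nu 'X_[m] = mmap1 (@nu_gen n rk) m.
Proof. exact: mmapX. Qed.

(** The D that satisfy this for all P form a subalgebra, so the generators suffice. *)
Lemma retr_nu D P : retr (nu D * P) = D * retr P.
Proof.
elim/mpoly_alg_ind: D P => [c P|p q Hp Hq P|p q Hp Hq P|l P].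
- by rewrite /nu mmapC !mul_mpolyC linearZ.
- by rewrite rmorphD /= !mulrDl linearD /= Hp Hq.
- by rewrite rmorphM /= -!mulrA Hp Hq.
- by rewrite nuX mmap1U retr_nu_gen.
Qed.

(** A symbol of weight k+1 goes to an elementary symmetric polynomial of degree k+1, so nu turns
    weight into degree. *)
Lemma dhomog_nu_mnm a : nu 'X_[a] \is (wgt a).-homog.
Proof.
rewrite nuX /mmap1 /Defs.wgt; apply: dhomog_bigprod => l; rewrite mulnC.
apply: dhomogMn; rewrite nu_genE.
have := dhomog_mesym (rk (tag (symb l))) rat (tagged (symb l)).+1.
move: (mesym _ _ _) => p p_homog; rewrite [p]mpolyE linear_sum big_seq.
apply: rpred_sum => m mp /=; rewrite factor_inclZ factor_inclX; apply: rpredZ.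
rewrite dhomogX /= -(dhomog_mf p_homog mp) /=.
rewrite /factor_mnm mdeg_sum mdegE; apply/eqP/eq_bigr => j _.
by rewrite mdegMn mdeg1 mul1n.
Qed.

End ProductRetraction.

(** * The Chern character on Sh_Q(Lambda) *)

(** A nonzero q has fewer than [size q] roots, so the first [size q] naturals already force q =
    0. *)
Lemma poly_nat_roots (q : {poly rat}) : (forall t : nat, q.[t%:R] = 0) -> q = 0.
Proof.
move=> q0; apply/eqP; apply: contraT => /max_poly_roots.
move=> /(_ [seq t%:R | t <- iota 0 (size q)]).
rewrite size_map size_iota ltnn; apply.
  by apply/allP => _ /mapP[t _ ->]; apply/rootP.
rewrite map_inj_uniq ?iota_uniq // => x y /eqP.
by rewrite eqr_nat => /eqP.
Qed.

(** Reduction modulo K gives the units digit, and division by K leaves the remaining ones. *)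
Lemma digits_inj K n (a b : 'I_n -> nat) :
  (forall i, a i < K)%N -> (forall i, b i < K)%N ->
  (\sum_i a i * K ^ i = \sum_i b i * K ^ i)%N -> a =1 b.
Proof.
elim: n a b => [|n IH] a b aK bK; first by move=> _ [].
have split_digits (c : 'I_n.+1 -> nat) :
    (\sum_i c i * K ^ i = (\sum_i c (fintype.lift ord0 i) * K ^ i) * K + c ord0)%N.
  rewrite big_ord_recl muln1 addnC big_distrl; congr (_ + _)%N.
  by apply: eq_bigr => i _; rewrite /= /bump /= add1n expnSr mulnA.
rewrite !split_digits => E; have K_gt0 : (0 < K)%N by apply: leq_ltn_trans (aK ord0).
have E0 : a ord0 = b ord0.
  by have := congr1 (modn^~ K) E; rewrite !modnMDl !modn_small.
have /IH {}IH : (\sum_i a (fintype.lift ord0 i) * K ^ i =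
                 \sum_i b (fintype.lift ord0 i) * K ^ i)%N.
  by have := congr1 (divn^~ K) E; rewrite !divnMDl // !divn_small // !addn0.
move=> i; case: (unliftP ord0 i) => [j ->|->] //.
by apply: IH => k.
Qed.

(* Kronecker's substitution x_i := t^(K^i) reduces this to one variable. *)
Lemma mpoly_int_roots n (p : {mpoly rat[n]}) :
  (forall x : 'I_n -> int, p.@[fun i => (x i)%:~R] = 0) -> p = 0.
Proof.
(* Exponents in p are at most its degree, hence below K, so distinct monomials of p go to distinct
   powers of t. *)
move=> p0; set K := msize p; pose q := mmap polyC (fun i : 'I_n => 'X^(K ^ i)) p.
have q0 : q = 0.
  apply: poly_nat_roots => t; rewrite -[RHS](p0 (fun i => (t ^ (K ^ i))%:Z)).
  rewrite /q /mmap mevalE horner_sum; apply: eq_bigr => m _.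
  rewrite hornerM hornerC /mmap1 horner_prod; congr (_ * _).
  by apply: eq_bigr => i _; rewrite !hornerE -natrX.
apply/eqP; apply: contraT; rewrite -msupp_eq0.
case sp: (msupp p) => [|m s] // _; have mp : m \in msupp p by rewrite sp mem_head.
have := congr1 (fun r : {poly rat} => r`_(\sum_i m i * K ^ i)%N) q0.
rewrite coef0 /q /mmap coef_sum.
have mX a : mmap1 (fun i : 'I_n => 'X^(K ^ i)) a = 'X^(\sum_i a i * K ^ i) :> {poly rat}.
  rewrite /mmap1 (big_morph (fun e => 'X^e) (exprD _) (expr0 _)).
  by apply: eq_bigr => i _; rewrite -exprM mulnC.
have digitK (a : 'X_{1..n}) i : a \in msupp p -> (a i < K)%N.
  move=> /msize_mdeg_lt; apply: leq_ltn_trans.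
  by rewrite mdegE (bigD1 i) //= leq_addr.
rewrite (bigD1_seq m) ?msupp_uniq //= mX coefCM coefXn eqxx mulr1.
rewrite big1_seq ?addr0 => [/eqP|a /andP[ne_am ap]].
  by rewrite mcoeff_eq0 mp.
rewrite mX coefCM coefXn; case: eqP => [E|]; last by rewrite mulr0.
case/eqP: ne_am; apply/mnmP => i.
by apply: (@digits_inj K) => // j; apply: digitK.
Qed.

(** * Linear maps out of the group algebra *)

Section GroupAlgebraLift.
Variables (R : comNzRingType) (M : zmodType) (V : lmodType R).
Implicit Types (D : galg R M) (F : M -> V).

Definition glift F D : V := \sum_(u <- dom D) coeff u D *: F u.

Lemma gliftwE F D (s : seq M) : uniq s -> {subset dom D <= s} ->
  glift F D = \sum_(u <- s) coeff u D *: F u.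
Proof.
move=> s_uniq sDs; rewrite [RHS](bigID (mem (dom D))) /= [X in _ + X]big1; last first.
  by move=> u /coeff_outdom ->; exact: scale0r.
rewrite addr0 -big_filter; apply/perm_big/uniq_perm; rewrite ?uniq_dom ?filter_uniq //.
by move=> u; rewrite mem_filter; case: (boolP (u \in dom D)) => // /sDs.
Qed.

Lemma glift_is_linear F : linear (glift F).
Proof.
move=> c D D'; set s := undup (dom (c *: D + D') ++ dom D ++ dom D').
have us : uniq s by exact: undup_uniq.
rewrite !(@gliftwE F _ s) // => [|u Du|u Du|u Du];
  rewrite ?mem_undup ?mem_cat ?Du ?orbT //.
rewrite scaler_sumr -big_split; apply: eq_bigr => u _.
by rewrite coeffD coeffZ scalerDl scalerA.
Qed.

HB.instance Definition _ F :=
  GRing.isLinear.Build R (galg R M) V _ (glift F) (glift_is_linear F).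

Lemma gliftU F c u : glift F (galgU c u) = c *: F u.
Proof.
rewrite (@gliftwE _ _ [:: u]) //; first by rewrite big_seq1 coeffU eqxx mulr1.
move=> v; rewrite mem_dom coeffU inE [u == v]eq_sym; case: (v == u) => //.
by rewrite /= mulr0 eqxx.
Qed.

End GroupAlgebraLift.

Lemma galg_ind (R : comNzRingType) (M : zmodType) (K : galg R M -> Prop) :
  K 0 -> (forall D D', K D -> K D' -> K (D + D')) -> (forall c u, K (galgU c u)) ->
  forall D, K D.
Proof.
move=> K0 KD KU D; rewrite -[D]freeg_sumE.
by elim/big_ind: _ => // u _; exact: KU.
Qed.

Lemma galgUM (R : comNzRingType) (M : zmodType) (c d : R) (u v : M) :
  galgU c u * galgU d v = galgU (c * d) (u + v).
Proof. exact: galg_mulU. Qed.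

Lemma galg1E (R : comNzRingType) (M : zmodType) : 1 = galgU 1 0 :> galg R M.
Proof. by []. Qed.

(** * Degree parts of ch and Taylor's formula *)

Section ChernCharacter.
Variables (n : nat) (rk : 'I_n -> nat).
Local Notation N := (nsym rk).
Implicit Types (u v : Lambda rk) (D : ShLambdaQ rk) (h : polyfun rk).

Lemma deriv_alongD u v : deriv_along (u + v) = deriv_along u + deriv_along v.
Proof.
rewrite /deriv_along -big_split; apply: eq_bigr => l _.
by rewrite mxE rmorphD scalerDl.
Qed.

Lemma deriv_along0 : deriv_along (0 : Lambda rk) = 0.
Proof. by rewrite /deriv_along big1 // => l _; rewrite mxE scale0r. Qed.

(** The degree-e part of exp(d_u); working with such parts keeps the computations inside
    polynomials. *)
Definition expd e u : {mpoly rat[N]} := (e`!%:R)^-1 *: deriv_along u ^+ e.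

Lemma expdD e u v :
  expd e (u + v) = \sum_(i < e.+1) expd i u * expd (e - i) v.
Proof.
rewrite /expd deriv_alongD addrC exprDn scaler_sumr; apply: eq_bigr => i _.
rewrite -scalerAl -scalerAr scalerA -scaler_nat scalerA [deriv_along v ^+ _ * _]mulrC.
congr (_ *: _); have le_ie : (i <= e)%N by rewrite -ltnS.
rewrite -(bin_fact le_ie) !natrM invfM mulrAC mulVf ?mul1r ?invfM //.
by rewrite pnatr_eq0 -lt0n bin_gt0.
Qed.

Lemma deriv_along_homog u : deriv_along u \is 1.-homog.
Proof.
apply: rpred_sum => l _; apply: rpredZ.
by rewrite dhomogX /= mdeg1.
Qed.

Lemma expd_homog e u : expd e u \is e.-homog.
Proof.
by apply: rpredZ; have := dhomogMn e (deriv_along_homog u); rewrite mul1n.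
Qed.

Definition chp e : ShLambdaQ rk -> {mpoly rat[N]} := glift (expd e).

HB.instance Definition _ e := GRing.Linear.copy (chp e) (glift (expd e)).

Lemma chpU e c u : chp e (galgU c u) = c *: expd e u.
Proof. exact: gliftU. Qed.

Lemma chp_homog e D : chp e D \is e.-homog.
Proof.
elim/galg_ind: D => [|D D' HD HD'|c u]; first by rewrite linear0 dhomog0.
  by rewrite linearD rpredD.
by rewrite chpU rpredZ // expd_homog.
Qed.

(** Both sides are bilinear, so [expdD], the binomial theorem, settles it on the basis elements
    T^u. *)
Lemma chpM e D D' : chp e (D * D') = \sum_(i < e.+1) chp i D * chp (e - i) D'.
Proof.
elim/galg_ind: D => [|D1 D2 H1 H2|c u].
- by rewrite mul0r linear0 big1 // => i _; rewrite linear0 mul0r.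
- rewrite mulrDl linearD /= H1 H2 -big_split; apply: eq_bigr => i _.
  by rewrite linearD mulrDl.
elim/galg_ind: D' => [|D1 D2 H1 H2|d v].
- by rewrite mulr0 linear0 big1 // => i _; rewrite linear0 mulr0.
- rewrite mulrDr linearD /= H1 H2 -big_split; apply: eq_bigr => i _.
  by rewrite linearD mulrDr.
rewrite galgUM chpU expdD scaler_sumr; apply: eq_bigr => i _.
by rewrite !chpU -[in RHS]scalerAl -[in RHS]scalerAr [RHS]scalerA.
Qed.

Lemma ch_LambdaE D b : ch_Lambda D b = (chp (mdeg b) D)@_b.
Proof.
rewrite /ch_Lambda /chp /glift raddf_sum; apply: eq_bigr => u _ /=.
by rewrite mcoeffZ /expd mcoeffZ /exp_deriv [_^-1 * _]mulrC.
Qed.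

(** ch(D) cut off at degree d. The cut is not multiplicative, but products are right in degrees
    below d, which is all that the pairing with h sees for d = [msize h]. *)
Definition chsum d D : {mpoly rat[N]} := \sum_(e < d) chp e D.

Lemma chsum_is_linear d : linear (chsum d).
Proof.
move=> c D D'; rewrite /chsum scaler_sumr -big_split; apply: eq_bigr => e _.
exact: linearP.
Qed.

HB.instance Definition _ d := GRing.isLinear.Build rat (ShLambdaQ rk) {mpoly rat[N]} _
  (chsum d) (chsum_is_linear d).

Lemma chsum_coef d D b : (mdeg b < d)%N -> (chsum d D)@_b = ch_Lambda D b.
Proof.
move=> lt_bd; rewrite /chsum raddf_sum (bigD1 (Ordinal lt_bd)) //= ch_LambdaE.
rewrite big1 ?addr0 // => e; rewrite -val_eqE /= eq_sym => ne_e.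
exact: dhomog_nemf_coeff (chp_homog e D) ne_e.
Qed.

(** Only parts whose degrees add up to [mdeg b] contribute, and all of these survive the cut. *)
Lemma chsumM_coef d D D' b : (mdeg b < d)%N ->
  (chsum d D * chsum d D')@_b = ch_Lambda (D * D') b.
Proof.
move=> lt_bd; rewrite ch_LambdaE chpM /chsum mulr_suml !raddf_sum /=.
rewrite [RHS](big_ord_widen d (fun i => (chp i D * chp (mdeg b - i) D')@_b)) //.
rewrite [RHS]big_mkcond; apply: eq_bigr => i _; rewrite mulr_sumr raddf_sum /=.
have coef0 (j : nat) : (i + j)%N != mdeg b -> (chp i D * chp j D')@_b = 0.
  by rewrite eq_sym; apply: dhomog_nemf_coeff (dhomogM _ _); exact: chp_homog.
case: ifP => [le_ib|/negbT gt_ib].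
  have lt_d : (mdeg b - i < d)%N by rewrite (leq_ltn_trans (leq_subr _ _)).
  rewrite (bigD1 (Ordinal lt_d)) //= big1 ?addr0 // => j; rewrite -val_eqE /= => ne.
  by apply: coef0; apply: contra ne => /eqP <-; rewrite addKn.
rewrite big1 // => j _; apply: coef0; apply: contra gt_ib => /eqP <-.
by rewrite ltnS leq_addr.
Qed.

Lemma mcoeffMXU (p : {mpoly rat[N]}) l b :
  (p * 'X_l)@_b = if b l == 0%N then 0 else p@_(b - U_(l)).
Proof.
case: eqP => [bl0|/eqP bl]; last first.
  by rewrite -{1}(submK (m := U_(l)) (m' := b)) ?lep1mP // addmC mcoeffMX.
rewrite [p]mpolyE mulr_suml raddf_sum big1 //= => m _.
rewrite -scalerAl -mpolyXD mcoeffZ mcoeffX; case: eqP => [E|]; last by rewrite mulr0.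
by move: bl0; rewrite -E mnmDE mnm1E eqxx addn1.
Qed.

(** The multinomial theorem by induction on e: splitting off one factor d_u gives a sum over l with
    weights b_l, which add up to e+1. *)
Lemma deriv_along_coef u e b : mdeg b = e ->
  (deriv_along u ^+ e)@_b * (mnmfact b)%:R =
  e`!%:R * \prod_l (u 0 l)%:~R ^+ b l.
Proof.
elim: e b => [|e IH] b.
  move=> /eqP; rewrite mdeg_eq0 => /eqP ->; rewrite expr0 mcoeff1 eqxx mul1r mul1r.
  rewrite /mnmfact !big1 // => l _; rewrite mnm0E //.
move=> be; rewrite exprSr {2}/deriv_along mulr_sumr raddf_sum mulr_suml /=.
transitivity (\sum_l (b l)%:R * (e`!%:R * \prod_k (u 0 k)%:~R ^+ b k : rat)); last first.
  by rewrite -mulr_suml -natr_sum -mdegE be mulrA -natrM factS.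
apply: eq_bigr => l _; rewrite -scalerAr mcoeffZ mcoeffMXU.
case: eqP => [->|/eqP bl]; first by rewrite mulr0 !mul0r.
have Eb : b = (b - U_(l) + U_(l))%MM by rewrite submK // lep1mP.
have Efact : mnmfact b = (b l * mnmfact (b - U_(l))%MM)%N.
  rewrite /mnmfact (bigD1 l) //= [in RHS](bigD1 l) //= mulnA; congr (_ * _)%N.
    rewrite mnmBE mnm1E eqxx subn1 -[in LHS](prednK (n := b l)) ?lt0n //.
    by rewrite factS prednK ?lt0n.
  by apply: eq_bigr => k ne; rewrite mnmBE mnm1E eq_sym (negPf ne) subn0.
have Eprod : \prod_k (u 0 k)%:~R ^+ b k =
    (u 0 l)%:~R * \prod_k (u 0 k)%:~R ^+ (b - U_(l))%MM k :> rat.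
  rewrite (bigD1 l) //= [in RHS](bigD1 l) //= mulrA; congr (_ * _).
    by rewrite mnmBE mnm1E eqxx subn1 -exprS prednK ?lt0n.
  by apply: eq_bigr => k ne; rewrite mnmBE mnm1E eq_sym (negPf ne) subn0.
have := IH (b - U_(l))%MM; rewrite Efact Eprod natrM mulrACA => ->; last first.
  by move: be; rewrite {1}Eb mdegD mdeg1 addn1 => -[].
by rewrite [_ * (b l)%:R]mulrC -mulrA; congr (_ * _); rewrite mulrCA.
Qed.

Lemma chU_coef v b :
  ch_Lambda (galgU 1 v) b = (\prod_l (v 0 l)%:~R ^+ b l) / (mnmfact b)%:R.
Proof.
rewrite ch_LambdaE chpU scale1r mcoeffZ; apply: (mulIf (mnmfact_neq0 b)).
rewrite -mulrA (deriv_along_coef _ erefl) divfK ?mnmfact_neq0 //.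
by rewrite mulKf // pnatr_eq0 -lt0n fact_gt0.
Qed.

(** In this form only the coefficients of P at monomials of h have to be known. *)
Lemma pairing_suppE h P :
  pairing h P = \sum_(m <- msupp h) P@_m * (h@_m * (mnmfact m)%:R).
Proof.
set k := maxn (msize P) (msize h).
rewrite /pairing (@mliftwE _ _ _ _ _ k) ?leq_maxl //.
rewrite (big_mksub 'X_{1..N < k}) ?msupp_uniq //=; last first.
  by move=> m /msize_mdeg_lt /leq_trans; apply; rewrite leq_maxr.
rewrite [RHS]big_rmcond //= => m /memN_msupp_eq0 ->.
by rewrite mul0r mulr0.
Qed.

(** Taylor's formula at the origin: ch(T^v) has coefficients v^b / b!, and the pairing cancels
    b!. *)
Lemma taylor h v : pairing h (chsum (msize h) (galgU 1 v)) = fun_of_poly h v.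
Proof.
rewrite pairing_suppE /fun_of_poly mevalE big_seq [RHS]big_seq.
apply: eq_bigr => m mh; rewrite chsum_coef ?msize_mdeg_lt // chU_coef.
by rewrite [h@_m * _]mulrC mulrA divfK ?mnmfact_neq0 // mulrC.
Qed.

Definition shiftQ D h (x : Lambda rk) : rat :=
  \sum_(u <- dom D) coeff u D * fun_of_poly h (x + u).

Lemma pairing_chsumM h D D' :
  pairing h (chsum (msize h) D * chsum (msize h) D') =
  pairing h (chsum (msize h) (D * D')).
Proof.
rewrite -[X in pairing h X]mulr1 -[X in _ = pairing h X]mulr1.
by apply: pairing_eq_low => b lt_b; rewrite chsumM_coef // chsum_coef.
Qed.

(** Evaluating at x + u amounts to applying T^u T^x at the origin, and ch is multiplicative as far
    as the pairing sees. *)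
Lemma shiftQ_pairing D h x :
  shiftQ D h x = pairing h (chsum (msize h) D * chsum (msize h) (galgU 1 x)).
Proof.
rewrite pairing_chsumM.
transitivity (glift (fun u => fun_of_poly h (x + u) : rat^o) D); first by [].
elim/galg_ind: D => [|D D' HD HD'|c u]; first by rewrite mul0r !linear0.
  by rewrite mulrDl !linearD /= HD HD'.
rewrite gliftU galgUM mulr1 -taylor addrC.
have -> : galgU c (u + x) = c *: galgU 1 (u + x) :> ShLambdaQ rk.
  by apply/eqP/freeg_eqP => w; rewrite coeffZ !coeffU mul1r.
by rewrite !linearZ.
Qed.

(* x |-> (D h)(x) is polynomial, with coefficients the pairings of h with
   ch(D) times a monomial. *)
Lemma shiftQ_eq0 D h :
  (forall x, shiftQ D h x = 0) <->
  (forall Q, pairing h (chsum (msize h) D * Q) = 0).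
Proof.
split=> [D0 Q|D0 x]; last by rewrite shiftQ_pairing D0.
pose P := chsum (msize h) D.
pose c b := pairing h (P * 'X_[b]).
pose p := trunc_series (msize h) (fun b => c b / (mnmfact b)%:R : rat).
have p0 : p = 0.
  apply: mpoly_int_roots => x; rewrite -[RHS](D0 (\row_l x l)) shiftQ_pairing -/P.
  rewrite mulrC (@pairing_eq_low _ _ _
    (trunc_series (msize h) (ch_Lambda (galgU 1 (\row_l x l))))) => [|b lt_b]; last first.
    by rewrite mcoeff_trunc lt_b chsum_coef.
  rewrite /p /trunc_series mulr_suml !raddf_sum; apply: eq_bigr => b _ /=.
  rewrite mevalZ mevalX -scalerAl pairingZ [_ * P]mulrC -/(c b) chU_coef.
  rewrite mulrAC [RHS]mulrC [RHS]mulrA; congr (_ * _ / _).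
  by apply: eq_bigr => l _; rewrite mxE.
rewrite -/P mulrC [Q]mpolyE mulr_suml raddf_sum big1 // => b _ /=.
rewrite -scalerAl pairingZ [_ * P]mulrC -/(c b).
suff -> : c b = 0 by rewrite mulr0.
(* For the b beyond the truncation of p, the product with ch(D) has too high a degree to pair with
   h. *)
have [lt_b|ge_b] := ltnP (mdeg b) (msize h); last first.
  rewrite /c mulrC; apply: pairing_high => b' lt_b'; rewrite mcoeffX.
  by case: eqP => // E; move: lt_b'; rewrite -E ltnNge ge_b.
have := congr1 (mcoeff b) p0; rewrite mcoeff0 /p mcoeff_trunc lt_b => /eqP.
by rewrite mulf_eq0 invr_eq0 (negPf (mnmfact_neq0 b)) orbF => /eqP.
Qed.

End ChernCharacter.

(** * Integral and rational group algebras *)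

Section GroupAlgebraRational.
Variable M : zmodType.

Lemma coeff_galgQ (D : galg int M) u : coeff u (galgQ D) = (coeff u D)%:~R.
Proof.
rewrite /galgQ raddf_sum /=; under eq_bigr do rewrite coeffU.
have [uD|uD] := boolP (u \in dom D); last first.
  rewrite coeff_outdom // big1_seq // => v /andP[_ vD].
  by case: eqP uD => [<-|]; rewrite ?vD ?mulr0.
rewrite (bigD1_seq u) ?uniq_dom //= eqxx mulr1 big1 ?addr0 // => v ne.
by rewrite (negPf ne) mulr0.
Qed.

Lemma galg_clear_den (D : galg rat M) :
  exists2 k : int, k != 0 & exists D', galgQ D' = k%:~R *: D.
Proof.
have [k k0 kP] := rat_common_den (dom D) (fun u => coeff u D).
exists k => //; exists (\sum_(u <- dom D) galgU (numq (k%:~R * coeff u D)) u : galg int M).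
apply/eqP/freeg_eqP => v; rewrite coeff_galgQ coeffZ raddf_sum /=.
under eq_bigr do rewrite coeffU.
have [vD|vD] := boolP (v \in dom D); last first.
  rewrite [in RHS]coeff_outdom // mulr0 big1_seq // => u /andP[_ uD].
  by case: eqP vD => [<-|]; rewrite ?uD ?mulr0.
rewrite (bigD1_seq v) ?uniq_dom //= eqxx mulr1 big1 ?addr0 ?kP // => u ne.
by rewrite (negPf ne) mulr0.
Qed.

End GroupAlgebraRational.

(** * The Chern character on Q K_h *)

Section ChernQuotient.
Variables (n : nat) (rk : 'I_n -> nat) (h : polyfun rk).
Implicit Type D : ShLambdaQ rk.

Definition chA D : QA h := qproj _ (chsum (msize h) D).

Lemma chA_zmod_morphism : zmod_morphism chA.
Proof. by move=> D D'; rewrite /chA !raddfB. Qed.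

HB.instance Definition _ := GRing.isZmodMorphism.Build (ShLambdaQ rk) (QA h)
  chA chA_zmod_morphism.

Lemma chA_monoid_morphism : monoid_morphism chA.
Proof.
split=> [|D D'].
  rewrite -(rmorph1 (qproj _)); apply: QA_eq_low => b lt_b.
  rewrite chsum_coef // ch_LambdaE galg1E chpU scale1r /expd.
  rewrite deriv_along0 expr0n mdeg_eq0 mcoeff1; case: eqP => [->|_].
    by rewrite mdeg0 fact0 invr1 scale1r mcoeff1 eqxx.
  by rewrite scaler0 mcoeff0.
rewrite /chA -rmorphM; apply: QA_eq_low => b lt_b.
by rewrite chsum_coef // chsumM_coef.
Qed.

HB.instance Definition _ := GRing.isMonoidMorphism.Build (ShLambdaQ rk) (QA h)
  chA chA_monoid_morphism.

Lemma chA_projA D : chA D = projA h (ch_Lambda D).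
Proof. by apply/esym/projA_poly => b lt_b; rewrite chsum_coef. Qed.

Lemma chA_eq0 D : chA D = 0 <-> forall x, shiftQ D h x = 0.
Proof. by rewrite shiftQ_eq0; exact: QA_eq0. Qed.

Lemma shiftQ_galgQ (D : ShLambda rk) x :
  shiftQ (galgQ D) h x = shift_Lambda D (fun_of_poly h) x.
Proof.
transitivity (glift (fun u => fun_of_poly h (x + u) : rat^o) (galgQ D)); first by [].
rewrite /galgQ linear_sum; apply: eq_bigr => u _.
by rewrite /= gliftU.
Qed.

Lemma chA_Ann (D : ShLambda rk) : chA (galgQ D) = 0 <-> Ann_Lambda h D.
Proof.
by rewrite chA_eq0; split=> H x; move: (H x); rewrite shiftQ_galgQ.
Qed.

(** This is injectivity of ch on Q K_h: a nonzero integer multiple of D is integral and kills h, so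
    D lies in the ideal of integral annihilators. *)
Lemma projK_Lambda_eq0 D : chA D = 0 -> projK_Lambda h D = 0.
Proof.
move=> D0; apply/qproj_eq0; have [k k0 [D']] := galg_clear_den D.
(* The ideal is closed under ring multiplication, so scalars are rewritten as multiples of T^0. *)
have -> : k%:~R *: D = galgU k%:~R 0 * D.
  elim/galg_ind: D {D0} => [|D1 D2 H1 H2|c u]; first by rewrite scaler0 mulr0.
    by rewrite scalerDr H1 H2 mulrDr.
  rewrite galgUM add0r; apply/eqP/freeg_eqP => w.
  by rewrite coeffZ !coeffU mulrA.
move=> D'E; have -> : D = galgU (k%:~R^-1) 0 * galgQ D'.
  by rewrite D'E mulrA galgUM mulVf ?intr_eq0 // addr0 -galg1E mul1r.
apply/ideal_genM/ideal_gen_mem; exists D' => //.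
by apply/chA_Ann; rewrite D'E rmorphM /= D0 mulr0.
Qed.

Lemma ch_Lambda_descends : exists ch_h : {rmorphism QK_Lambda h -> QA h},
  forall D, ch_h (projK_Lambda h D) = projA h (ch_Lambda D).
Proof.
have chA_gen (x : ShLambdaQ rk) :
  (exists2 D, Ann_Lambda h D & x = galgQ D) -> chA x = 0 by case=> D AD ->; exact/chA_Ann.
have [phi phiE] := quot_rmorphism chA_gen.
by exists phi => D; rewrite -chA_projA -phiE.
Qed.

End ChernQuotient.

(** * The series ch(D) for D in Sh_Q(Sigma) *)

Section NuSeries.
Variables (n : nat) (rk : 'I_n -> nat).
Local Notation N := (nsym rk).
Local Notation wgt := (@wgt n rk).
Implicit Types (D : {mpoly rat[N]}) (P : diffseries rk).

Lemma nu_coef0 D b : (forall a, wgt a = mdeg b -> D@_a = 0) -> (nu D)@_b = 0.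
Proof.
move=> D0; rewrite [D]mpolyE (linear_sum (@nu n rk)) raddf_sum big1 // => a _ /=.
rewrite nuZ mcoeffZ; have [/D0->|ne] := eqVneq (wgt a) (mdeg b); first by rewrite mul0r.
by rewrite (dhomog_nemf_coeff (dhomog_nu_mnm a)) ?mulr0 // eq_sym.
Qed.

Lemma mdeg_le_wgt a : (mdeg a <= wgt a)%N.
Proof. by rewrite mdegE /Defs.wgt leq_sum // => l _; rewrite leq_pmulr. Qed.

(** [nu_Diff] truncates by degree, while the relevant a have weight [mdeg b]; by [mdeg_le_wgt] none
    of them is cut off. *)
Lemma nu_Diff_coef P D b :
  (forall a, wgt a = mdeg b -> P a = D@_a) -> nu_Diff P b = (nu D)@_b.
Proof.
move=> PD; have -> : nu_Diff P b = (nu (trunc_series (mdeg b).+1 P))@_b.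
  rewrite /nu_Diff /trunc_series (linear_sum (@nu n rk)) raddf_sum; apply: eq_bigr => a _ /=.
  by rewrite nuZ mcoeffZ nuX.
apply/eqP; rewrite -subr_eq0 -mcoeffB -rmorphB; apply/eqP/nu_coef0 => a wa.
by rewrite mcoeffB mcoeff_trunc ltnS -wa mdeg_le_wgt PD // subrr.
Qed.

Lemma nu_Diff_onto (F : diffseries rk) :
  (forall e, exists D, forall b, mdeg b = e -> F b = (nu D)@_b) ->
  exists P, nu_Diff P = F.
Proof.
(* Only the a of weight e influence degree e, so polynomials chosen separately for each e glue to
   one series. *)
move=> /choice[Q QP]; exists (fun a => (Q (wgt a))@_a); apply/funext => b.
by rewrite (QP _ b erefl); apply: nu_Diff_coef => a ->.
Qed.

End NuSeries.

(** * Symmetry of ch(iota D) *)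

Section ChernSigma.
Variables (n : nat) (rk : 'I_n -> nat).
Local Notation N := (nsym rk).
Implicit Types (D : {mpoly rat[N]}).

(** The sums over k-subsets are the Chern roots of the k-th exterior power; this is their e-th power
    sum, e! times the degree-e part of ch. *)
Definition sympow_sum r k e : {mpoly rat[r]} :=
  \sum_(h : {set 'I_r} | #|h| == k) (\sum_(j in h) 'X_j) ^+ e.

(** A permutation of the variables permutes the k-element subsets. *)
Lemma sympow_sum_sym r k e : sympow_sum r k e \is symmetric.
Proof.
apply/issymP => s; rewrite /sympow_sum rmorph_sum /=.
rewrite [RHS](reindex_inj (imset_inj (@perm_inj _ s))) /=.
apply: eq_big => [h|h _]; first by rewrite card_imset //; exact: perm_inj.
rewrite rmorphXn rmorph_sum big_imset /=; last by move=> ? ? _ _; exact: perm_inj.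
by congr (_ ^+ _); apply: eq_bigr => j _; rewrite /msym mmapX mmap1U.
Qed.

Lemma nu_gen_idx i (k : 'I_(rk i)) :
  nu_gen (idx k) = factor_incl (mesym (rk i) rat k.+1).
Proof. by rewrite /nu_gen symb_idx factor_incl_mesym. Qed.

Lemma factor_incl_symmetric i (p : {mpoly rat[rk i]}) :
  p \is symmetric -> exists D, factor_incl p = nu D.
Proof.
(* The expression t in the elementary symmetric polynomials, read in the symbols [c_k(E_i)], is the
   preimage under nu. *)
move=> /sym_fundamental[t [<- _]]; exists (factor_incl t).
elim/mpoly_alg_ind: t => [c|p1 p2 H1 H2|p1 p2 H1 H2|k].
- by rewrite comp_mpolyC /factor_incl mmapC /nu mmapC.
- by rewrite !rmorphD /= H1 H2.
- by rewrite !rmorphM /= H1 H2.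
rewrite comp_mpolyXU -tnth_nth tnth_mktuple -nu_gen_idx.
by rewrite [in RHS]/factor_incl mmapX mmap1U nuX mmap1U.
Qed.

Definition galgC (c : rat) : ShLambdaQ rk := galgU c 0.

Lemma galgC_zmod_morphism : zmod_morphism galgC.
Proof.
by move=> c d; apply/eqP/freeg_eqP => w; rewrite coeffB !coeffU mulrBl.
Qed.

HB.instance Definition _ := GRing.isZmodMorphism.Build rat (ShLambdaQ rk)
  galgC galgC_zmod_morphism.

Lemma galgC_monoid_morphism : monoid_morphism galgC.
Proof. by split=> // c d; rewrite /galgC galgUM addr0. Qed.

HB.instance Definition _ := GRing.isMonoidMorphism.Build rat (ShLambdaQ rk)
  galgC galgC_monoid_morphism.

Definition iota_gen (l : 'I_N) : ShLambdaQ rk :=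
  (mesym (rk (tag (symb l))) (ShLambdaQ rk) (tagged (symb l)).+1).@[
    fun j => Tu j].

HB.instance Definition _ :=
  GRing.RMorphism.copy (@iota_Sh n rk) (mmap galgC iota_gen).

Lemma iota_ShC c : iota_Sh c%:MP = galgC c :> ShLambdaQ rk.
Proof. exact: (mmapC _ galgC). Qed.

Lemma iota_ShX l : iota_Sh 'X_l = iota_gen l.
Proof. by rewrite -(mmap1U iota_gen l); exact: (mmapX _ galgC). Qed.

Lemma chp_iota_gen e l : chp e (iota_gen l) =
  factor_incl ((e`!%:R)^-1 *: sympow_sum (rk (tag (symb l))) (tagged (symb l)).+1 e).
Proof.
rewrite /iota_gen; move: (tagged (symb l)).+1 => k; move: (tag (symb l)) => i.
rewrite linearZ /= /sympow_sum !rmorph_sum linear_sum scaler_sumr.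
apply: eq_bigr => h _ /=; rewrite rmorph_prod rmorphXn rmorph_sum /=.
have -> : \prod_(j in h) (('X_j).@[fun j : 'I_(rk i) => Tu j] : ShLambdaQ rk) =
    galgU 1 (\sum_(j in h) delta_mx 0 (idx j)).
  under eq_bigr do rewrite mevalXU.
  elim/big_rec2: _ => [//|j x y _ ->]; rewrite /Tu galgUM mulr1.
  by congr (galgU _ _); rewrite addrC.
rewrite chpU scale1r /expd; congr (_ *: _ ^+ _).
transitivity (\sum_(j in h) deriv_along (delta_mx 0 (idx j) : Lambda rk)).
  by elim/big_rec2: _ => [|j x y _ <-]; rewrite ?deriv_along0 ?deriv_alongD.
apply: eq_bigr => j _; rewrite /factor_incl mmapX mmap1U /deriv_along.
rewrite (bigD1 (idx j)) //= mxE !eqxx scale1r big1 ?addr0 // => l' ne.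
by rewrite mxE (negPf ne) andbF scale0r.
Qed.

(** Induction over the algebra generators. By [chpM] a part of a product is a convolution, so the
    induction hypothesis is needed for all e at once. *)
Lemma chp_iota_nu e D : exists Q, chp e (iota_Sh D) = nu Q.
Proof.
elim/mpoly_alg_ind: D e => [c e|p q Hp Hq e|p q Hp Hq e|l e].
- exists (c *: (e`!%:R^-1 *: 0 ^+ e)); rewrite iota_ShC /galgC chpU /expd deriv_along0.
  by rewrite !linearZ rmorphXn /= rmorph0.
- have [P PE] := Hp e; have [Q QE] := Hq e; exists (P + Q).
  by rewrite rmorphD linearD /= PE QE rmorphD.
- have /choice[P PE] := Hp; have /choice[Q QE] := Hq.
  exists (\sum_(i < e.+1) P i * Q (e - i)%N); rewrite rmorphM chpM rmorph_sum.
  by apply: eq_bigr => i _; rewrite /= rmorphM /= PE QE.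
- rewrite iota_ShX chp_iota_gen; apply: factor_incl_symmetric.
  by apply: rpredZ; exact: sympow_sum_sym.
Qed.

(** All degree parts of ch(iota D) lie in the image of nu, so the series exists and the default
    value in [ch_Sigma] is never taken. *)
Lemma nu_ch_Sigma D : nu_Diff (ch_Sigma D) = ch_Lambda (iota_Sh D).
Proof.
rewrite /ch_Sigma; case: pselect => [exP|[]]; first exact: (projT2 (cid exP)).
apply: nu_Diff_onto => e; have [Q QE] := chp_iota_nu e D; exists Q => b be.
by rewrite ch_LambdaE be QE.
Qed.

End ChernSigma.

(** * The polynomial h and the embedding of Q A_g *)

Section PolynomialOnLambda.
Variables (n : nat) (rk : 'I_n -> nat) (g : polyfun rk) (d : nat).
Hypothesis g_homog : g \is d.-homog for (@wgt n rk).
Local Notation N := (nsym rk).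

(** The pairing is diagonal on monomials, and those of g have weight d. *)
Lemma pairing_wgt0 e P : P \is e.-homog for (@wgt n rk) -> e != d -> pairing g P = 0.
Proof.
move=> P_homog ne; rewrite pairing_suppE big1_seq // => m /andP[_ mg].
rewrite (dhomog_nemf_coeff P_homog) ?mul0r //.
by rewrite (dhomog_mf g_homog mg) eq_sym.
Qed.

(* The factor 1/m! makes [pairing lift_poly] equal to [pairing g \o retr]; only
   the m of degree d contribute, as [retr] is graded. *)
Definition lift_poly : polyfun rk :=
  trunc_series d.+1 (fun m => pairing g (retr 'X_[m]) / (mnmfact m)%:R : rat).

Lemma retrX_pairing0 m : mdeg m != d -> pairing g (retr 'X_[m]) = 0.
Proof.
by move=> ne; apply: pairing_wgt0 ne; rewrite /retr mliftX; exact: retr_mnm_homog.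
Qed.

Lemma lift_poly_homog : lift_poly \is d.-homog.
Proof.
apply/dhomogP => m; rewrite mcoeff_msupp mcoeff_trunc /=.
have [//|/retrX_pairing0->] := eqVneq (mdeg m) d.
by rewrite mul0r if_same eqxx.
Qed.

Lemma pairing_lift_poly P : pairing lift_poly P = pairing g (retr P).
Proof.
elim/mpolyind: P => [|c m P _ _ IH]; first by rewrite !linear0.
rewrite !linearD /= IH; congr (_ + _).
rewrite !linearZ /=; congr (_ *: _); rewrite pairingX mcoeff_trunc.
case: ifP => [_|/negbT]; first by rewrite divfK ?mnmfact_neq0.
rewrite -leqNgt mul0r => lt_dm; rewrite retrX_pairing0 //.
by rewrite gtn_eqF.
Qed.

(** Q[c]-linearity of [retr] moves the test against Q[u] to Q[c]. Conversely the test polynomials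
    [nu Q] suffice, as [retr (nu D * nu Q)] is D * Q. *)
Lemma nu_QA_eq0 D :
  (qproj _ (nu D) = 0 :> QA lift_poly) <-> (qproj _ D = 0 :> QA g).
Proof.
rewrite !QA_eq0; split=> D0 Q; last by rewrite pairing_lift_poly retr_nu D0.
by have := D0 (nu Q); rewrite pairing_lift_poly -[nu Q]mulr1 !retr_nu retr1 mulr1.
Qed.

Lemma nu_descends : exists nu_gh : {rmorphism QA g -> QA lift_poly},
  (forall P, nu_gh (projA g P) = projA lift_poly (nu_Diff P)) /\ injective nu_gh.
Proof.
have nu_gen0 (x : {mpoly rat[N]}) :
    (exists2 D, Ann_Diff g D & x = map_mpoly intr D) ->
    (qproj _ (nu x) : QA lift_poly) = 0.
  by move=> Gx; apply/nu_QA_eq0/qproj_eq0/ideal_gen_mem.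
have [phi phiE] := @quot_rmorphism _ _ _ (qproj _ \o @nu n rk) nu_gen0.
exists phi; split=> [P|]; last first.
  apply: raddf_inj => x x0; rewrite -[x]qreprK; apply/nu_QA_eq0.
  by rewrite -[LHS]phiE qreprK.
(* The cut at k is late enough for both projections: an a of weight [mdeg b] has degree at most
   [mdeg b], hence below k. *)
set k := maxn (msize g) (msize lift_poly).
have -> : projA g P = qproj _ (trunc_series k P).
  by apply: projA_poly => b lt_b; rewrite mcoeff_trunc leq_max lt_b.
rewrite phiE; apply/esym/projA_poly => b lt_b; apply: nu_Diff_coef => a wa.
rewrite mcoeff_trunc leq_max orbC (leq_ltn_trans _ lt_b) // -wa.
exact: mdeg_le_wgt.
Qed.

End PolynomialOnLambda.

Theorem theorem4p9 (n : nat) (rk : 'I_n -> nat) (rk_gt0 : forall i, (0 < rk i)%N)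
    (f : Sigma rk -> rat) (g : polyfun rk) (fgRR : Riemann_Roch_pair f g) :
  (forall D : {mpoly rat[nsym rk]}, nu_Diff (ch_Sigma D) = ch_Lambda (iota_Sh D)) /\
  exists h : polyfun rk,
    (exists d : nat, h \is d.-homog) /\
    exists (ch_fg : {rmorphism QK_Sigma f -> QA g})
           (ch_h : {rmorphism QK_Lambda h -> QA h})
           (iota_fh : {rmorphism QK_Sigma f -> QK_Lambda h})
           (nu_gh : {rmorphism QA g -> QA h}),
      (forall D, ch_fg (projK_Sigma f D) = projA g (ch_Sigma D)) /\
      (forall D, ch_h (projK_Lambda h D) = projA h (ch_Lambda D)) /\
      (forall D, iota_fh (projK_Sigma f D) = projK_Lambda h (iota_Sh D)) /\
      (forall P, nu_gh (projA g P) = projA h (nu_Diff P)) /\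
      injective iota_fh /\
      injective nu_gh /\
      (forall x, nu_gh (ch_fg x) = ch_h (iota_fh x)).
Proof.
split; first exact: nu_ch_Sigma.
have [[d g_homog] [ch_fg [ch_fg_bij ch_fgE]]] := fgRR.
pose h := lift_poly g d; exists h; split; first by exists d; exact: lift_poly_homog.
have [ch_h ch_hE] := ch_Lambda_descends h.
have [nu_gh [nu_ghE nu_gh_inj]] := nu_descends g_homog.
have square D : nu_gh (ch_fg (projK_Sigma f D)) = ch_h (projK_Lambda h (iota_Sh D)).
  by rewrite ch_fgE nu_ghE ch_hE nu_ch_Sigma.
have iota_gen0 (x : {mpoly rat[nsym rk]}) :
    (exists2 D, Ann_Sigma f D & x = map_mpoly intr D) ->
    (qproj _ (iota_Sh x) : QK_Lambda h) = 0.
  (* x vanishes in Q K_f, so the square gives ch(iota x) = 0 in Q A_h, and ch is injective on Q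
     K_h. *)
  move=> Gx; apply: projK_Lambda_eq0; rewrite chA_projA -ch_hE -square.
  have -> : projK_Sigma f x = 0 by apply/qproj_eq0/ideal_gen_mem.
  by rewrite !rmorph0.
have [iota_fh iota_fhE] := @quot_rmorphism _ _ _ (qproj _ \o @iota_Sh n rk) iota_gen0.
have squareK x : nu_gh (ch_fg x) = ch_h (iota_fh x).
  by rewrite -[x]qreprK square; congr (ch_h _); rewrite [RHS]iota_fhE.
exists ch_fg, ch_h, iota_fh, nu_gh; do ![split=> //].
(* The injective composite of nu and ch factors through iota, so iota is injective. *)
apply: raddf_inj => x x0; apply: (bij_inj ch_fg_bij); apply: nu_gh_inj.
by rewrite squareK x0 !rmorph0.
Qed.
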